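(* There exists a universal constant $c > 0$ (independent of $t$, $p$ and $f$) such that for every $t \in (0,1)$, every $1 \leq p \leq \infty$ and every $f \in L_p(\mathbb{T})$ with $\int_{\mathbb{T}} f = 0$ we have $$\| f - U_t f \| \geq c t^2 \| f \|,$$ where $\|\cdot\|$ denotes the $L_p(\mathbb{T})$ norm and $U_t$ is the averaging operator $$(U_t f)(x) = \frac{1}{2t} \int_{-t}^{t} f(x \oplus s) \, ds .$$
   Context: $\mathbb{T} = \mathbb{R}/\mathbb{Z}$ is the one-dimensional torus, a compact group with addition modulo 1, $x \oplus y = (x+y) \bmod 1$ for $x, y \in \mathbb{R}$, equipped with its Haar probability measure (Lebesgue measure on $[0,1)$). The $L_p(\mathbb{T})$ norm is $\|f\| = \left(\int_{\mathbb{T}} |f|^p\right)^{1/p}$ for $1 \le p < \infty$ and $\|f\| = \mathrm{ess\,sup}_{\mathbb{T}} |f|$ for $p = \infty$. *)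

(* Defs.v *)
From HB Require Import structures.
From mathcomp Require Import all_boot all_order all_algebra.
From mathcomp Require Import all_classical all_reals all_analysis.

Set Implicit Arguments.
Unset Strict Implicit.
Unset Printing Implicit Defensive.

Import Order.TTheory GRing.Theory Num.Theory.
Import numFieldNormedType.Exports.

Local Open Scope classical_set_scope.
Local Open Scope ring_scope.

(* A function on the torus R/Z is encoded as a function R -> R of which only
   the values on the fundamental domain [0, 1[ matter: torus_measure does not
   charge the complement of [0, 1[, and tadd takes its values in [0, 1[. In
   particular such functions are not assumed to be 1-periodic. *)

Definition tadd (R : realType) (x y : R) : R := x + y - (Num.floor (x + y))%:~R.

Notation "x ⊕ y" := (tadd x y) (at level 50, left associativity) : ring_scope.

Lemma tadd_itv (R : realType) (x y : R) : x ⊕ y \in `[0, 1[.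
Proof.
by rewrite in_itv/= subr_ge0 floor_le/= ltrBlDl -intrD1 floorD1_gt.
Qed.

Definition torus_measure {R : realType} : set (measurableTypeR R) -> \bar R :=
  mrestr (@lebesgue_measure R) (measurable_itv (`[0, 1[ : interval R)).

HB.instance Definition _ (R : realType) :=
  Measure.on (@torus_measure R).

Lemma torus_measure_setT (R : realType) :
  torus_measure [set: measurableTypeR R] = 1%E.
Proof.
by rewrite /torus_measure /mrestr setTI lebesgue_measure_itv/= lte01 oppr0 adde0.
Qed.

HB.instance Definition _ (R : realType) :=
  Measure_isProbability.Build _ _ _ (@torus_measure R)
    (torus_measure_setT R).

Definition torus_avg (R : realType) (t : R) (f : R -> R) (x : R) : R :=
  (2 * t)^-1 * \int[lebesgue_measure]_(s in `[- t, t]) f (x ⊕ s).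

(* Main.v *)
Require Import Defs.
From mathcomp Require Import all_boot all_order all_algebra.
From mathcomp Require Import all_classical all_reals all_analysis.
From mathcomp Require Import measurable_realfun ess_sup_inf.
From mathcomp Require Import ring lra.
Import Order.TTheory GRing.Theory Num.Theory.
Import numFieldNormedType.Exports.

(** Write U for the averaging operator at scale t, and g = f - U f. The aim is
    an identity that recovers f from g up to an operator which contracts every
    L_p norm by a factor independent of t and p.

    To second order U - 1 is (t^2/6) times the second derivative, so U is
    inverted approximately by the Green function of the circle, which is the
    quadratic m(r) = (3/t^2) (r^2 - r) on [0,1), extended periodically: its
    second derivative is (6/t^2) (1 - delta), where delta is the Dirac mass
    at 0. Averaging m gives the exact formula U m = m + 1 - w
    [torus_avg_green], where w is a nonnegative bump of mass 1 supported in
    [-t,t], namely w(s) = 3 (t - |s|)^2 / (2 t^3). Let M and W be the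
    convolutions with m and w. If f has mean zero then
        M g = M f - M U f = W f,
    and since f = U f + g,
        f = (U - W) f + g + M g             [green_representation].

    The kernels of U and W both have mass 1, which allows cancellation: the L1
    distance between them is the integral of |1 - 3 u^2| over u in [0,1], that
    is 4/(3 sqrt 3) < 9/10, whatever the value of t [excess_integral_le] (when
    t > 1/2 the supports wrap around the circle, which can only decrease the
    distance). The kernel of M is bounded by 3/(4 t^2). By the Schur test
    [schur_test] these L1 bounds on the kernels bound the operators on all L_p
    at once, so
        |f| <= (9/10) |f| + (1 + 3/(4 t^2)) |g|
    in L_p norm. Absorbing the first term on the left gives the theorem, with
    c = 1/20.

    All operators are written as integral operators with bounded kernels over
    the torus measure. Composition of such operators is then Fubini's theorem,
    and the identities hold at every point rather than almost everywhere. *)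

Set Implicit Arguments.
Unset Strict Implicit.
Unset Printing Implicit Defensive.

Local Open Scope classical_set_scope.
Local Open Scope ring_scope.

(** * Integral operators with bounded kernels *)

Section kernel_operators.
Context {d : measure_display} {T : measurableType d} {R : realType}.
Variable mu : probability T R.

Definition kernel_op (K : T -> T -> R) (f : T -> R) (x : T) : R :=
  \int[mu]_y (K x y * f y).

Definition bounded_kernel (K : T -> T -> R) : Prop :=
  measurable_fun [set: T * T] (fun z => K z.1 z.2) /\
  exists B : R, forall x y, `|K x y| <= B.

Lemma bounded_kernel_cst c : bounded_kernel (fun _ _ => c).
Proof. by split => //; exists `|c|. Qed.

Lemma measurable_kernel_section K x :
  bounded_kernel K -> measurable_fun [set: T] (K x).
Proof.
move=> [mK _]; exact: (measurableT_comp mK (pair1_measurable x)).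
Qed.

Lemma integrable_kernelM K f x : bounded_kernel K ->
  mu.-integrable [set: T] (EFin \o f) ->
  mu.-integrable [set: T] (EFin \o (fun y => K x y * f y)).
Proof.
move=> bK fi; have [_ [B KB]] := bK.
have := @integrableMr _ _ _ mu setT measurableT (K x) (EFin \o f).
apply => //; first exact: measurable_kernel_section.
exists B; split; first exact: num_real.
by move=> b Bb y _ /=; rewrite (le_trans (KB _ _))// ltW.
Qed.

Lemma integrable_kernel K x : bounded_kernel K ->
  mu.-integrable [set: T] (EFin \o K x).
Proof.
move=> bK.
have h : mu.-integrable [set: T] (EFin \o (fun=> 1 : R)).
  exact: finite_measure_integrable_cst.
have := integrable_kernelM x bK h.
by congr (_.-integrable _ _); apply/funext => y /=; rewrite mulr1.
Qed.

(** This is what Fubini's theorem requires in [kernel_op_comp]; the case where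
    K is constant gives the integrability of [kernel_op L f]. *)
Lemma integrable_kernelM_prod K L f x : bounded_kernel K -> bounded_kernel L ->
  mu.-integrable [set: T] (EFin \o f) ->
  (mu \x mu)%E.-integrable [set: T * T]
    (fun z => (K x z.1 * L z.1 z.2 * f z.2)%:E).
Proof.
move=> bK bL fi; have [_ [B KB]] := bK; have [mL [C LC]] := bL.
have mf : measurable_fun [set: T] f by exact/measurable_EFinP/(measurable_int mu).
have mKL : measurable_fun [set: T * T] (fun z => K x z.1 * L z.1 z.2 * f z.2).
  apply: measurable_funM.
    apply: measurable_funM => //.
    exact: (measurableT_comp (measurable_kernel_section x bK) measurable_fst).
  exact: (measurableT_comp mf measurable_snd).
have mnKL : measurable_fun [set: T * T]
    (fun z => `|(K x z.1 * L z.1 z.2 * f z.2)%:E|%E).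
  by apply: measurableT_comp => //; exact/measurable_EFinP.
apply/integrable12ltyP; first exact/measurable_EFinP.
apply: (@le_lt_trans _ _ (\int[mu]_x0 \int[mu]_y ((B * C)%:E * `|f y|%:E))%E).
  apply: ge0_le_integral => //.
  - by move=> y _; exact: integral_ge0.
  - exact: (measurable_fun_fubini_tonelli_F _ mnKL).
  - move=> y _; apply: ge0_le_integral => //.
    + exact: (measurableT_comp mnKL (pair1_measurable y)).
    + by apply: emeasurable_funM => //; do 2 apply/measurableT_comp => //.
    + move=> z _; rewrite /= -EFinM lee_fin !normrM ler_wpM2r//.
      by rewrite ler_pM.
have -> : (\int[mu]_x0 \int[mu]_y ((B * C)%:E * `|f y|%:E) =
    \int[mu]_y ((B * C)%:E * `|f y|%:E))%E.
  by rewrite integral_cst//= probability_setT mule1.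
have := integrableZl measurableT (B * C) (integrable_abse fi).
by move/integrable_lty => /(_ measurableT).
Qed.

Lemma integrable_kernel_op K f : bounded_kernel K ->
  mu.-integrable [set: T] (EFin \o f) ->
  mu.-integrable [set: T] (EFin \o kernel_op K f).
Proof.
move=> bK fi.
have h := integrable_kernelM_prod point (bounded_kernel_cst 1) bK fi.
have := @integrable_fubini_F _ _ _ _ _ mu mu _ h.
congr (_.-integrable _ _); apply/funext => x; rewrite /fubini_F /= /kernel_op.
rewrite /Rintegral fineK; last first.
  by apply: integrable_fin_num => //; exact: integrable_kernelM.
by apply: eq_integral => y _; rewrite mul1r.
Qed.

Lemma measurable_kernel_op K f : bounded_kernel K ->
  mu.-integrable [set: T] (EFin \o f) ->
  measurable_fun [set: T] (kernel_op K f).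
Proof.
move=> bK fi; apply/measurable_EFinP.
exact: measurable_int (integrable_kernel_op bK fi).
Qed.

Lemma bounded_kernel_swap K : bounded_kernel K ->
  bounded_kernel (fun y x => K x y).
Proof.
move=> [mK [B KB]]; split; last by exists B => *.
exact: (measurableT_comp mK (@measurable_swap _ _ T T)).
Qed.

(** Boundedness of the kernels makes all the integrals converge absolutely for
    every x, so the composition formula has no exceptional null set. *)
Lemma kernel_op_comp K L f x : bounded_kernel K -> bounded_kernel L ->
  mu.-integrable [set: T] (EFin \o f) ->
  kernel_op K (kernel_op L f) x =
  kernel_op (fun x z => \int[mu]_y (K x y * L y z)) f x.
Proof.
move=> bK bL fi.
have h := integrable_kernelM_prod x bK bL fi.
have KLi z : mu.-integrable [set: T] (EFin \o (fun y => K x y * L y z)).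
  have bL' := bounded_kernel_swap bL.
  exact: integrable_kernelM (integrable_kernel z bL').
transitivity (fine (\int[mu]_y \int[mu]_z (K x y * L y z * f z)%:E)%E).
  congr fine; apply: eq_integral => y _.
  rewrite EFinM /kernel_op /Rintegral fineK; last first.
    by apply: integrable_fin_num => //; exact: integrable_kernelM.
  rewrite -integralZl//; last exact: integrable_kernelM.
  by apply: eq_integral => z _; rewrite -EFinM mulrA.
rewrite (Fubini h); congr fine; apply: eq_integral => z _.
rewrite EFinM /Rintegral fineK; last by apply: integrable_fin_num => //; exact: KLi.
by rewrite -integralZr //; exact: KLi.
Qed.

Lemma kernel_opBr K f g x : bounded_kernel K ->
  mu.-integrable [set: T] (EFin \o f) -> mu.-integrable [set: T] (EFin \o g) ->
  kernel_op K (f \- g) x = kernel_op K f x - kernel_op K g x.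
Proof.
move=> bK fi gi; rewrite /kernel_op -RintegralB//; last 2 first.
- exact: integrable_kernelM.
- exact: integrable_kernelM.
by apply: eq_Rintegral => y _; rewrite /= mulrBr.
Qed.

Lemma kernel_opDl K L f x : bounded_kernel K -> bounded_kernel L ->
  mu.-integrable [set: T] (EFin \o f) ->
  kernel_op (fun x y => K x y + L x y) f x = kernel_op K f x + kernel_op L f x.
Proof.
move=> bK bL fi; rewrite /kernel_op -RintegralD//; last 2 first.
- exact: integrable_kernelM.
- exact: integrable_kernelM.
by apply: eq_Rintegral => y _; rewrite mulrDl.
Qed.

Lemma kernel_opBl K L f x : bounded_kernel K -> bounded_kernel L ->
  mu.-integrable [set: T] (EFin \o f) ->
  kernel_op (fun x y => K x y - L x y) f x = kernel_op K f x - kernel_op L f x.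
Proof.
move=> bK bL fi; rewrite /kernel_op -RintegralB//; last 2 first.
- exact: integrable_kernelM.
- exact: integrable_kernelM.
by apply: eq_Rintegral => y _; rewrite mulrBl.
Qed.

Lemma bounded_kernelD K L : bounded_kernel K -> bounded_kernel L ->
  bounded_kernel (fun x y => K x y + L x y).
Proof.
move=> [mK [B KB]] [mL [C LC]]; split; first exact: measurable_funD.
by exists (B + C) => x y; rewrite (le_trans (ler_normD _ _))// lerD.
Qed.

End kernel_operators.

(** * The Schur test in L_p *)

Section schur.
Context {d : measure_display} {T : measurableType d} {R : realType}.
Variable mu : probability T R.
Local Notation kernel_op := (kernel_op mu).
Implicit Types (K : T -> T -> R) (f : T -> R).

Lemma abse_kernel_op_le K f x : bounded_kernel K ->
  mu.-integrable [set: T] (EFin \o f) ->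
  (`|kernel_op K f x|%:E <= \int[mu]_y (`|K x y| * `|f y|)%:E)%E.
Proof.
move=> bK fi; have iKf := integrable_kernelM x bK fi.
rewrite /kernel_op EFin_normr_Rintegral//.
apply: (le_trans (le_abse_integral _ _ _)) => //.
  exact: measurable_int iKf.
by under eq_integral do rewrite /= normrM.
Qed.

(** Jensen's inequality for the measure with density |K x y|, of mass at most A.
    It follows from Hoelder's inequality applied to the factorization of
    |K| |f| as |K|^(1/q) times (|K|^(1/r) |f|), with q conjugate to r. The case
    r = 1, where q would be infinite, is an equality. *)
Lemma kernel_op_jensen K (A r : R) f x : bounded_kernel K -> 0 <= A ->
  (\int[mu]_y `|K x y|%:E <= A%:E)%E -> 1 <= r ->
  measurable_fun setT f ->
  (((\int[mu]_y (`|K x y| * `|f y|)%:E) `^ r) <=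
   (A `^ (r - 1))%:E * \int[mu]_y (`|K x y| * `|f y| `^ r)%:E)%E.
Proof.
move=> bK A0 KA; rewrite le_eqVlt => /predU1P[<- mf|r1 mf].
  rewrite subrr powRr0 mul1e poweRe1; last by apply: integral_ge0 => y _; rewrite lee_fin.
  by under [leRHS]eq_integral do rewrite powRr1//.
have mK := measurable_kernel_section x bK.
have r0 : 0 < r by lra.
pose q := r / (r - 1).
have q0 : 0 < q by rewrite divr_gt0//; lra.
have qr : q^-1 + r^-1 = 1 by rewrite /q; field; apply/andP; split; lra.
have mKn : measurable_fun setT (fun y => `|K x y|) by exact: measurableT_comp.
have mfn : measurable_fun setT (fun y => `|f y|) by exact: measurableT_comp.
have mKp s : measurable_fun setT (fun y => `|K x y| `^ s).
  exact: (measurableT_comp (measurable_powR s) mKn).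
have := @hoelder _ _ _ mu (fun y => `|K x y| `^ q^-1)
  (fun y => `|K x y| `^ r^-1 * `|f y|) q r (mKp _) _ q0 r0 qr.
move=> /(_ (measurable_funM (mKp _) mfn)).
rewrite Lnorm1.
have -> : (\int[mu]_x0 `|(EFin \o ((fun y => `|K x y| `^ q^-1) \*
    (fun y => (`|K x y| `^ r^-1 * `|f y|)%R))%R) x0| =
  \int[mu]_y (`|K x y| * `|f y|)%:E)%E.
  apply: eq_integral => y _ /=; congr EFin.
  rewrite ger0_norm ?mulr_ge0 ?powR_ge0// mulrA -powRD ?qr ?powRr1//.
  by rewrite oner_eq0.
set I := (X in (X <= _)%E) => IH.
have I0 : (0 <= I)%E by apply: integral_ge0 => y _; rewrite lee_fin mulr_ge0.
have : (I `^ r <= ('N[mu]_q%:E[EFin \o (fun y => (`|K x y| `^ q^-1)%R)] *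
   'N[mu]_r%:E[EFin \o (fun y => (`|K x y| `^ r^-1 * `|f y|)%R)]) `^ r)%E.
  apply: gt0_ler_poweR => //; first exact: ltW.
  - by rewrite in_itv/= leey I0.
  - by rewrite in_itv/= leey andbT mule_ge0 ?Lnorm_ge0.
move/le_trans; apply; rewrite poweRM ?Lnorm_ge0//.
rewrite [X in (_ * X <= _)%E]powR_Lnorm ?gt_eqF//.
apply: lee_pmul; [exact: poweR_ge0|by apply: integral_ge0 => *; exact: poweR_ge0| |].
  rewrite unlock -poweRrM.
  rewrite (eq_integral (fun y => `|K x y|%:E)); last first.
    move=> y _ /=; rewrite ger0_norm ?powR_ge0// -powRrM mulVf ?gt_eqF// powRr1//.
  have -> : q^-1 * r = r - 1 by rewrite /q; field; apply/andP; split; lra.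
  rewrite -poweR_EFin; apply: gt0_ler_poweR => //; first by lra.
  - by rewrite in_itv/= leey andbT; apply: integral_ge0 => *; rewrite lee_fin.
  - by rewrite in_itv/= leey lee_fin A0.
rewrite le_eqVlt; apply/orP; left; apply/eqP; apply: eq_integral => y _ /=.
rewrite ger0_norm ?mulr_ge0 ?powR_ge0// powRM ?powR_ge0// -powRrM mulVf ?gt_eqF//.
by rewrite powRr1.
Qed.

(** For finite p, integrate [kernel_op_jensen] in x and exchange the integrals:
    the row bound contributes A^(p-1) and the column bound contributes A. For
    infinite p the row bound gives the estimate at each x. *)
Lemma schur_test K (A : R) f (p : \bar R) : bounded_kernel K -> 0 <= A ->
  (forall x, \int[mu]_y `|K x y|%:E <= A%:E)%E ->
  (forall y, \int[mu]_x `|K x y|%:E <= A%:E)%E ->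
  (1 <= p)%E -> mu.-integrable [set: T] (EFin \o f) ->
  ('N[mu]_p[EFin \o kernel_op K f] <= A%:E * 'N[mu]_p[EFin \o f])%E.
Proof.
move=> bK A0 KA1 KA2 p1 fi.
have mf : measurable_fun setT f by exact/measurable_EFinP/(measurable_int mu).
have bK' : bounded_kernel (fun y x => K x y) by exact: bounded_kernel_swap.
case: p p1 => [r| |//] p1.
- rewrite lee_fin in p1; have r0 : 0 < r by lra.
  have r0' := ltW r0.
  have mfp : measurable_fun setT (fun y => `|f y| `^ r).
    apply: (measurableT_comp (measurable_powR r)); exact: measurableT_comp.
  rewrite unlock.
  have -> : A%:E = ((A `^ r)%:E `^ r^-1)%E.
    by rewrite poweR_EFin -powRrM mulfV ?gt_eqF// powRr1.
  rewrite -poweRM ?integral_ge0//; last 2 first.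
  - by rewrite lee_fin powR_ge0.
  - by move=> y _; exact: poweR_ge0.
  apply: gt0_ler_poweR; first by rewrite invr_ge0.
  - by rewrite in_itv/= leey andbT; apply: integral_ge0 => y _; rewrite lee_fin powR_ge0.
  - rewrite in_itv/= leey andbT mule_ge0 ?lee_fin ?powR_ge0//.
    by apply: integral_ge0 => y _; rewrite lee_fin powR_ge0.
  (* Both sides are now compared as r-th powers. *)
  pose G x y := (`|K x y| * `|f y| `^ r)%:E.
  have mG : measurable_fun [set: T * T] (fun z => G z.1 z.2).
    apply/measurable_EFinP; apply: measurable_funM.
      by apply: measurableT_comp => //; case: bK.
    exact: (measurableT_comp mfp measurable_snd).
  have G0 x y : (0 <= G x y)%E by rewrite lee_fin mulr_ge0 ?powR_ge0.
  apply: (@le_trans _ _ (\int[mu]_x ((A `^ (r - 1))%:E * \int[mu]_y G x y))%E).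
    apply: ge0_le_integral => //.
    + by move=> x _; exact: poweR_ge0.
    + apply: (measurableT_comp (measurable_poweR r)).
      by do 2 apply: measurableT_comp => //; exact: measurable_kernel_op.
    + apply: emeasurable_funM => //.
      exact: (measurable_fun_fubini_tonelli_F _ mG).
    + move=> x _; apply: le_trans (kernel_op_jensen _ _ _ _ _) => //.
      apply: gt0_ler_poweR => //.
      * by rewrite in_itv/= leey lee_fin normr_ge0.
      * by rewrite in_itv/= leey andbT integral_ge0// => y _; rewrite lee_fin.
      * exact: abse_kernel_op_le.
  rewrite ge0_integralZl//; last 3 first.
  - exact: (measurable_fun_fubini_tonelli_F _ mG).
  - by move=> x _; exact: integral_ge0.
  - by rewrite lee_fin powR_ge0.
  rewrite (fubini_tonelli (fun z => G z.1 z.2))//.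
  apply: (@le_trans _ _ ((A `^ (r - 1))%:E * \int[mu]_y (A%:E * (`|f y| `^ r)%:E))%E).
    apply: lee_pmul => //; first by rewrite lee_fin powR_ge0.
    - by apply: integral_ge0 => y _; exact: integral_ge0.
    apply: ge0_le_integral => //.
    + by move=> y _; exact: integral_ge0.
    + exact: (measurable_fun_fubini_tonelli_G _ mG).
    + by apply: emeasurable_funM => //; exact/measurable_EFinP.
    + move=> y _; rewrite /G.
      under eq_integral do rewrite /= EFinM.
      rewrite ge0_integralZr//.
      * by apply: lee_pmul => //; apply: integral_ge0 => *; rewrite lee_fin.
      * do 2 apply: measurableT_comp => //; exact: measurable_kernel_section bK'.
  rewrite ge0_integralZl//; last exact/measurable_EFinP.
  rewrite muleA -EFinM -[X in (_ * X)%R](powRr1 A0) -powRD ?subrK//.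
  by apply/implyP => /eqP; lra.
- have T0 : (0 < mu [set: T])%E by rewrite probability_setT.
  rewrite unlock T0.
  set N := ess_sup mu (abse \o (EFin \o f)).
  have N0 : (0 <= N)%E by apply: ess_sup_gee => //; apply: nearW => y /=.
  apply/ess_supP; apply: nearW => x /=.
  apply: le_trans (abse_kernel_op_le x bK fi) _.
  apply: (@le_trans _ _ (\int[mu]_y (`|K x y|%:E * N))%E).
    apply: ae_ge0_le_integral => //.
    + apply/measurable_EFinP; apply: measurable_funM; apply: measurableT_comp => //.
      exact: measurable_kernel_section.
    + by move=> y _; exact: mule_ge0.
    + apply: emeasurable_funM => //; do 2 apply: measurableT_comp => //.
      exact: measurable_kernel_section.
    + have := ess_sup_ge mu (abse \o (EFin \o f)).
      apply: filterS => y /= yN _; rewrite EFinM; apply: lee_pmul => //.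
  rewrite ge0_integralZr//; last first.
    do 2 apply: measurableT_comp => //; exact: measurable_kernel_section.
  by apply: lee_pmul => //; apply: integral_ge0 => y _; rewrite lee_fin.
Qed.
End schur.

(** * Translation invariance of the torus measure *)

Section torus.
Context {R : realType}.
Implicit Types x y z s a : R.
Local Notation tau := (@torus_measure R).
Local Notation lambda := (@lebesgue_measure R).

Lemma taddE (n : int) x y : n%:~R <= x + y < n%:~R + 1 -> x ⊕ y = x + y - n%:~R.
Proof.
by move=> h; rewrite /tadd (@floor_def _ _ n)// intrD.
Qed.

(** Torus addition only depends on the real sum modulo the integers; all the
    algebraic identities below reduce to this. *)
Lemma tadd_shift (n : int) x y x' y' : x + y = x' + y' + n%:~R ->
  x ⊕ y = x' ⊕ y'.
Proof.
move=> e; rewrite /tadd e floorDrz ?intr_int// intrKfloor intrD; ring.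
Qed.

Lemma taddC x y : x ⊕ y = y ⊕ x.
Proof. by rewrite /tadd (addrC x). Qed.

Lemma tadd_taddl x y z : (x ⊕ y) ⊕ z = x ⊕ (y + z).
Proof.
apply: (@tadd_shift (- Num.floor (x + y))).
rewrite {1}/tadd rmorphN /=; ring.
Qed.

Lemma tadd_ge0 x y : 0 <= x ⊕ y.
Proof. by have := tadd_itv x y; rewrite in_itv/= => /andP[]. Qed.

Lemma tadd_lt1 x y : x ⊕ y < 1.
Proof. by have := tadd_itv x y; rewrite in_itv/= => /andP[]. Qed.

Lemma tadd0_id x : 0 <= x < 1 -> 0 ⊕ x = x.
Proof. by move=> h; rewrite (@taddE 0) ?add0r ?subr0. Qed.

Lemma measurable_tadd :
  measurable_fun [set: R * R] (fun z : R * R => z.1 ⊕ z.2).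
Proof.
have mD : measurable_fun [set: R * R] (fun z : R * R => z.1 + z.2).
  by apply: measurable_funD; [exact: measurable_fst|exact: measurable_snd].
have mfl : measurable_fun [set: R] (fun x : R => (Num.floor x)%:~R : R).
  by apply: nondecreasing_measurable => // a b ab; rewrite ler_int le_floor.
by apply: measurable_funB => //; exact: (measurableT_comp mfl mD).
Qed.

Lemma measurable_taddr x : measurable_fun [set: R] (fun s => x ⊕ s).
Proof. exact: (measurableT_comp measurable_tadd (pair1_measurable x)). Qed.

Lemma lebesgue_measure_translation a (A : set R) : measurable A ->
  lambda ((fun s => s + a) @^-1` A) = lambda A.
Proof.
move=> mA.
have ms : measurable_fun [set: measurableTypeR R]
   (fun s : measurableTypeR R => (s + a : measurableTypeR R)).
  exact: measurable_funD.
apply/esym; apply: (@lebesgue_measure_unique R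
  (pushforward lambda (fun s : measurableTypeR R => (s + a : measurableTypeR R))))
  => // _ [[c e]] _ <-.
transitivity (lambda `](c - a), (e - a)]%classic).
  rewrite !lebesgue_measure_itv/= !lte_fin ltrD2r; case: ifPn => // _.
  by rewrite -!EFinB; congr EFin; ring.
congr (lambda _); apply/seteqP.
by split => s /=; rewrite !in_itv/= ltrBlDr lerBrDr.
Qed.

Lemma torus_integralE (F : R -> \bar R) : measurable_fun [set: R] F ->
  (\int[tau]_s F s = \int[lambda]_(s in `[0%R, 1%R[) F s)%E.
Proof.
move=> mF.
have -> : [set: R] = `[(0 : R), 1[%classic `|` ~` `[(0 : R), 1[%classic by rewrite setUv.
rewrite integral_setU//=; last 3 first.
- exact: measurableC.
- by rewrite setUv.
- by rewrite disj_set2E setICr.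
rewrite [X in (_ + X)%E]null_set_integral//; last 3 first.
- exact: measurableC.
- exact: measurable_funTS.
- by rewrite -[RHS](measure0 lambda); congr (lambda _); rewrite setICl.
rewrite adde0; apply: eq_measure_integral => A mA AD.
by congr (lambda _); rewrite setIidl.
Qed.

(** With a the representative of x in [0,1), the translation moves [0,1-a) to
    [a,1) and [1-a,1) to [0,a); each piece is a translation of the line. *)
Lemma torus_measure_translation x (A : set R) : measurable A ->
  tau ((fun s => x ⊕ s) @^-1` A) = tau A.
Proof.
move=> mA; rewrite /torus_measure /mrestr.
pose a := x ⊕ 0.
have a0 : 0 <= a := tadd_ge0 _ _.
have a1 : a < 1 := tadd_lt1 _ _.
have xa s : x ⊕ s = a ⊕ s.
  by rewrite /a tadd_taddl add0r.
have -> : (fun s => x ⊕ s) @^-1` A `&` `[0, 1[ =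
   ((fun s => s + a) @^-1` (A `&` `[a, 1[)) `|`
   ((fun s => s + (a - 1)) @^-1` (A `&` `[0, a[)).
  apply/seteqP; split => s /=; rewrite !in_itv/= xa.
    move=> [As /andP[s0 s1]]; have [h|h] := ltP (a + s) 1.
      left; rewrite (@taddE 0) ?subr0 in As; last by rewrite add0r; lra.
      by rewrite addrC; split => //; lra.
    right; rewrite (@taddE 1) in As; last by lra.
    by rewrite (_ : s + _ = a + s - 1); [split => //; lra|ring].
  case=> [] [As h].
    rewrite (@taddE 0) ?subr0; last by rewrite add0r; lra.
    by rewrite addrC; split => //; lra.
  rewrite (@taddE 1); last by lra.
  by rewrite (_ : a + s - _ = s + (a - 1)); [split => //; lra|ring].
have mA1 : measurable (A `&` `[a, 1[) by exact: measurableI.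
have mA2 : measurable (A `&` `[0, a[) by exact: measurableI.
have mp c B : measurable B -> measurable ((fun s : R => s + c) @^-1` B).
  move=> mB; rewrite -[X in measurable X]setTI.
  have mc : measurable_fun [set: R] (fun s : R => s + c) by exact: measurable_funD.
  exact: mc.
rewrite measureU//=; last 3 first.
- exact: mp.
- exact: mp.
- by apply/seteqP; split => s //=; rewrite !in_itv/= => -[[_ h1] [_ h2]]; lra.
rewrite !lebesgue_measure_translation//.
rewrite -measureU//=; last first.
  by apply/seteqP; split => s //=; rewrite !in_itv/= => -[[_ h1] [_ h2]]; lra.
congr (lambda _); rewrite -setIUr; congr (_ `&` _).
by apply/seteqP; split => s /=; rewrite !in_itv/=; [case|case: (ltP s a) => _ h; [right|left]]; lra.
Qed.

Lemma ge0_integral_torus_translation x (F : R -> \bar R) :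
  measurable_fun [set: R] F -> (forall s, 0 <= F s)%E ->
  (\int[tau]_s F (x ⊕ s) = \int[tau]_s F s)%E.
Proof.
move=> mF F0.
have := @ge0_integral_pushforward _ _ (measurableTypeR R) (measurableTypeR R) R
  (fun s => x ⊕ s) (measurable_taddr x) tau setT F measurableT mF (fun y _ => F0 y).
rewrite preimage_setT => <-; apply: eq_measure_integral => [|? A mA _].
  exact: measurable_taddr.
exact: torus_measure_translation.
Qed.

Lemma integrable_torus_translation x (F : R -> \bar R) :
  tau.-integrable setT F -> tau.-integrable setT (fun s => F (x ⊕ s)).
Proof.
move=> /integrableP[mF iF]; apply/integrableP; split.
  exact: (measurableT_comp mF (measurable_taddr x)).
rewrite (ge0_integral_torus_translation x (F := fun s => `|F s|%E))//.
exact: measurableT_comp.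
Qed.

Lemma integral_torus_translation x (F : R -> \bar R) :
  tau.-integrable setT F ->
  (\int[tau]_s F (x ⊕ s) = \int[tau]_s F s)%E.
Proof.
move=> iF; have mF := measurable_int _ iF.
have := @integral_pushforward _ _ (measurableTypeR R) (measurableTypeR R) R
  (fun s => x ⊕ s) (measurable_taddr x) tau setT F mF.
rewrite preimage_setT => <- //; last exact: integrable_torus_translation.
apply: eq_measure_integral => [|? A mA _]; first exact: measurable_taddr.
exact: torus_measure_translation.
Qed.

End torus.

(** * The averaging operator as a convolution *)

Section average.
Context {R : realType}.
Implicit Types x y z s a t : R.
Local Notation tau := (@torus_measure R).
Local Notation lambda := (@lebesgue_measure R).

Lemma integral_lebesgue_translation a (D : set R) (G : R -> \bar R) :
  measurable D -> measurable_fun [set: R] G ->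
  lambda.-integrable ((fun s => s + a) @^-1` D) (fun s => G (s + a)%R) ->
  (\int[lambda]_(s in D) G s =
   \int[lambda]_(s in (fun s => (s + a)%R) @^-1` D) G (s + a)%R)%E.
Proof.
move=> mD mG iG.
have ms : measurable_fun [set: measurableTypeR R]
   (fun s : measurableTypeR R => (s + a : measurableTypeR R)).
  exact: measurable_funD.
have := @integral_pushforward _ _ (measurableTypeR R) (measurableTypeR R) R
  _ ms lambda D G mG iG mD.
move=> <-; apply: eq_measure_integral => B mB _.
exact/esym/lebesgue_measure_translation.
Qed.

Lemma integral_indicM (D A : set R) (g : R -> R) : measurable A -> A `<=` D ->
  (\int[lambda]_(s in D) (\1_A s * g s)%:E = \int[lambda]_(s in A) (g s)%:E)%E.
Proof.
move=> mA AD; rewrite -[in RHS](setIidr AD) integral_mkcondr.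
by rewrite epatch_indic; apply: eq_integral => s _; rewrite -EFinM mulrC.
Qed.

Definition conv_kernel (k : R -> R) x y : R := k (y ⊕ - x).

Lemma bounded_conv_kernel (k : R -> R) (B : R) : measurable_fun [set: R] k ->
  (forall r, 0 <= r < 1 -> `|k r| <= B) ->
  @bounded_kernel _ (measurableTypeR R) R (conv_kernel k).
Proof.
move=> mk kB; split; last first.
  by exists B => x y; apply: kB; rewrite tadd_ge0 tadd_lt1.
have mp : measurable_fun [set: R * R] (fun z : R * R => (z.2, - z.1)).
  by apply: measurable_fun_pair => //; exact: measurableT_comp.
exact: (measurableT_comp mk (measurableT_comp measurable_tadd mp)).
Qed.

Lemma integrable_torus (F : R -> \bar R) : tau.-integrable setT F ->
  lambda.-integrable `[0, 1[ F.
Proof.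
move=> /integrableP[mF iF]; apply/integrableP; split.
  exact: measurable_funTS.
by rewrite -torus_integralE//; exact: measurableT_comp.
Qed.

Lemma kernel_op_conv (k f : R -> R) (B : R) x : measurable_fun [set: R] k ->
  (forall r, 0 <= r < 1 -> `|k r| <= B) ->
  tau.-integrable setT (EFin \o f) ->
  kernel_op tau (conv_kernel k) f x = \int[lambda]_(s in `[0, 1[) (k s * f (x ⊕ s)).
Proof.
move=> mk kB fi.
have bk := bounded_conv_kernel mk kB.
have iF := @integrable_kernelM _ _ _ tau _ f x bk fi.
rewrite /kernel_op /Rintegral -(integral_torus_translation x iF).
rewrite torus_integralE; last first.
  exact: measurable_int (integrable_torus_translation x iF).
congr fine; apply: eq_integral => s; rewrite inE/= in_itv/= => s01.
by rewrite /conv_kernel tadd_taddl (@tadd_shift _ 0 _ _ 0 s) ?tadd0_id//; ring.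
Qed.

Lemma integral_conv_kernel (k : R -> R) x : measurable_fun [set: R] k ->
  (\int[tau]_y `|conv_kernel k x y|%:E =
   \int[lambda]_(r in `[0%R, 1%R[) `|k r|%:E)%E.
Proof.
move=> mk.
have mk' : measurable_fun [set: R] (fun r => `|k r|%:E).
  by apply/measurable_EFinP; exact: measurableT_comp.
rewrite -(torus_integralE mk') -(ge0_integral_torus_translation (- x) mk').
  by apply: eq_integral => y _; rewrite /conv_kernel taddC.
by move=> s; rewrite lee_fin.
Qed.

(** The reflection r |-> 1 - r is negation on the torus away from 0, which is
    itself fixed by negation. *)
Lemma conv_kernel_sym (k : R -> R) x y :
  (forall r, 0 < r < 1 -> k (1 - r) = k r) ->
  conv_kernel k x y = conv_kernel k y x.
Proof.
move=> kE; rewrite /conv_kernel.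
have e : x ⊕ - y = 0 ⊕ - (y ⊕ - x).
  apply: (@tadd_shift _ (- Num.floor (y - x))).
  by rewrite {1}/tadd rmorphN /=; ring.
rewrite e; have := tadd_ge0 y (- x); have := tadd_lt1 y (- x).
move: (y ⊕ - x) => r r1; rewrite le_eqVlt => /predU1P[<-|r0].
  by rewrite oppr0 tadd0_id// lexx ltr01.
rewrite (@taddE _ (-1)); last by rewrite rmorphN /=; apply/andP; split; lra.
by rewrite -[in LHS](kE r) ?r0//; congr k; rewrite rmorphN /=; ring.
Qed.

(** The density of the uniform law on [-t,t] reduced modulo 1: for t < 1 the
    half [-t,0) is carried to [1-t,1). For t > 1/2 the two halves overlap, which
    is why the indicators are added. *)
Definition avg_profile t : R -> R :=
  fun r => (2 * t)^-1 * (\1_(`[0, t] : set R) r + \1_(`[1 - t, 1[ : set R) r).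

Lemma measurable_avg_profile t : measurable_fun [set: R] (avg_profile t).
Proof.
apply: measurable_funM => //; apply: measurable_funD => //;
  exact: measurable_indic.
Qed.

Lemma avg_profile_bound t r : 0 < t -> `|avg_profile t r| <= t^-1.
Proof.
move=> t0; rewrite /avg_profile !indicE normrM ger0_norm ?invr_ge0; last by lra.
rewrite ger0_norm ?addr_ge0//.
have -> : t^-1 = (2 * t)^-1 * 2 by field; lra.
rewrite ler_wpM2l// ?invr_ge0; first by lra.
by case: (_ \in _); case: (_ \in _) => /=; lra.
Qed.

(** The part of the integral over [-t,0) is translated to [1-t,1), where the
    integrand takes the same values by periodicity. *)
Lemma torus_avgE t (f : R -> R) x : 0 < t < 1 ->
  tau.-integrable setT (EFin \o f) ->
  torus_avg t f x = kernel_op tau (conv_kernel (avg_profile t)) f x.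
Proof.
move=> /andP[t0 t1] fi.
rewrite (kernel_op_conv _ (measurable_avg_profile t)
  (fun r _ => avg_profile_bound r t0) fi).
pose g s := f (x ⊕ s).
have gi : tau.-integrable setT (EFin \o g).
  exact: (integrable_torus_translation x fi).
have mg : measurable_fun [set: R] g by apply/measurable_EFinP; exact: measurable_int gi.
have gi1 : lambda.-integrable `[0, 1[ (EFin \o g) := integrable_torus gi.
have ind_int (A : set R) : measurable A -> A `<=` `[0, 1[ ->
    lambda.-integrable `[0, 1[ (EFin \o (fun s => \1_A s * g s)) /\
    \int[lambda]_(s in `[0, 1[) (\1_A s * g s) = \int[lambda]_(s in A) g s.
  move=> mA A01; split.
    have := @integrableMr _ _ _ lambda `[0, 1[%classic _ (\1_A) (EFin \o g).
    apply => //; exists 1; split; first exact: num_real.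
    move=> b b1 s _ /=; rewrite ger0_norm// indicE.
    by apply: le_trans (ltW b1); case: (_ \in _); rewrite /= ?ler01.
  by rewrite /Rintegral integral_indicM.
have [] := ind_int `[0, t]%classic.
- exact: measurable_itv.
- by move=> s /=; rewrite !in_itv/= => /andP[h1 h2]; apply/andP; split; lra.
move=> i1 e1.
have [] := ind_int `[1 - t, 1[%classic.
- exact: measurable_itv.
- by move=> s /=; rewrite !in_itv/= => /andP[h1 h2]; apply/andP; split; lra.
move=> i2 e2.
transitivity (\int[lambda]_(s in `[0, 1[)
  ((2 * t)^-1 * (\1_(`[0, t] : set R) s * g s + \1_(`[1 - t, 1[ : set R) s * g s))); last first.
  by apply: eq_Rintegral => s _; rewrite /avg_profile /g; ring.
rewrite RintegralZl//; last exact: (integrableD _ i1 i2).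
rewrite RintegralD// e1 e2 /torus_avg; congr (_ * _).
rewrite /Rintegral -/(g _).
have i2' : lambda.-integrable `[1 - t, 1[ (EFin \o g).
  apply: integrableS gi1 => //.
  by move=> s /=; rewrite !in_itv/= => /andP[h1 h2]; apply/andP; split; lra.
have i1' : lambda.-integrable `[0, t] (EFin \o g).
  apply: integrableS gi1 => //.
  by move=> s /=; rewrite !in_itv/= => /andP[h1 h2]; apply/andP; split; lra.
have E : `[- t, t]%classic = `[- t, 0[%classic `|` `[0, t]%classic.
  apply/seteqP; split => s /=; rewrite !in_itv/=; last by case; lra.
  by have [h|h] := ltP s 0 => ?; [left|right]; lra.
have pE : (fun s => s + -1) @^-1` `[- t, 0[%classic = `[1 - t, 1[%classic.
  by apply/seteqP; split => s /=; rewrite !in_itv/=; lra.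
have gE : (fun s => (g (s + - 1))%:E) = EFin \o g.
  by apply/funext => s /=; congr EFin; rewrite /g; congr f;
     apply: (@tadd_shift _ (-1)); ring.
have e3 : (\int[lambda]_(s in `[(- t)%R, 0%R[) (g s)%:E =
     \int[lambda]_(s in `[(1 - t)%R, 1%R[) (g s)%:E)%E.
  rewrite (@integral_lebesgue_translation (-1) _ (EFin \o g))//.
  - rewrite pE; apply: eq_integral => s _ /=.
    by rewrite -[LHS]/((fun s => (g (s + - 1))%:E) s) gE.
  - exact/measurable_EFinP.
  - by rewrite pE; rewrite /= gE.
rewrite E integral_setU//; last 2 first.
- exact/measurable_EFinP/measurable_funTS.
- by apply/disj_setPS => s /=; rewrite !in_itv/= => -[h1 h2]; lra.
rewrite e3 fineD; first exact: addrC.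
- by apply: integrable_fin_num i2'.
- by apply: integrable_fin_num i1'.
Qed.

End average.

(** * Antiderivatives and the positive part *)

Section calculus.
Context {R : realType}.
Implicit Types x y z s a b t : R.
Local Notation lambda := (@lebesgue_measure R).

Lemma integral_antiderivative (F f : R -> R) a b : a < b ->
  (forall x, is_derive x 1 F (f x)) -> continuous f ->
  (\int[lambda]_(x in `[a, b]) (f x)%:E = (F b - F a)%:E)%E.
Proof.
move=> ab dF cf; rewrite EFinB; apply: continuous_FTC2 => //.
- exact: continuous_subspaceT.
- have cF : continuous F.
    move=> x; apply: differentiable_continuous; apply/derivable1_diffP.
    by have [] := dF x.
  split; first by move=> x _; have [] := dF x.
  + exact/cvg_at_right_filter/cF.
  + exact/cvg_at_left_filter/cF.
- by move=> x _; rewrite derive1E; have [_ ->] := dF x.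
Qed.

(** Meant for the square of the positive part: its quadratic remainder bound has
    the same constant on both sides of 0 and across it, so that the kink needs no
    one-sided limits. *)
Lemma is_derive_quadratic_error (F : R -> R) x d C :
  (forall h, `|F (x + h) - F x - d * h| <= C * h ^+ 2) ->
  is_derive x 1 F d.
Proof.
move=> FC.
have H : h^-1 *: (F (h *: 1 + x) - F x) @[h --> 0^'] --> d.
  apply/cvgrPdist_le => e e0.
  exists (e / (`|C| + 1)) => /=; first by rewrite divr_gt0// ltr_pwDr.
  move=> h /= + h0; rewrite sub0r normrN ltr_pdivlMr ?ltr_pwDr// => he.
  rewrite /GRing.scale/= mulr1 (addrC h).
  have -> : d - h^-1 * (F (x + h) - F x) = - (h^-1 * (F (x + h) - F x - d * h)).
    by field.
  rewrite normrN normrM normfV mulrC ler_pdivrMr ?normr_gt0//.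
  rewrite (le_trans (FC h))// -(real_normK (num_real h)).
  have /ltW he' := he; have := normr_ge0 h; have := ler_norm C.
  move: (`|h|) he' => k; move: (`|C|) => D; nra.
have cvF : cvg (h^-1 *: (F (h *: 1 + x) - F x) @[h --> 0^']) by apply/cvg_ex; exists d.
by apply: DeriveDef => //; exact: cvg_lim.
Qed.

Definition pospart x : R := Num.max 0 x.

Lemma continuous_pospart a b : continuous (fun s => pospart (a * s + b)).
Proof.
have ca : continuous (fun s : R => a * s + b).
  move=> x; apply: cvgD; last exact: cvg_cst.
  by apply: cvgM; [exact: cvg_cst|exact: cvg_id].
rewrite (_ : (fun s => _) = fun s => ((a * s + b) + `|a * s + b|) / 2).
  move=> x; apply: cvgM; last exact: cvg_cst.
  by apply: cvgD; [exact: ca|apply: cvg_norm; exact: ca].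
apply/funext => s; rewrite /pospart.
by case: (lerP 0 (a * s + b)) => h; [rewrite ger0_norm|rewrite ltr0_norm]; lra.
Qed.

Lemma is_derive_pospart_sqr a b x :
  is_derive x 1 (fun s => pospart (a * s + b) ^+ 2) (2 * a * pospart (a * x + b)).
Proof.
apply: (@is_derive_quadratic_error _ _ _ (a ^+ 2)) => h.
have -> : a * (x + h) + b = (a * x + b) + a * h by ring.
move: (a * x + b) => y; have -> : a ^+ 2 * h ^+ 2 = (a * h) ^+ 2 by ring.
have -> : 2 * a * pospart y * h = 2 * pospart y * (a * h) by ring.
move: (a * h) => k; rewrite /pospart ler_norml; apply/andP.
by case: (leP 0 y) => h1; case: (leP 0 (y + k)) => h2; split; nra.
Qed.
End calculus.

(** * Averaging the Green function of the circle *)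

Section profiles.
Context {R : realType}.
Implicit Types x y z s a b t r : R.
Local Notation lambda := (@lebesgue_measure R).

(** The periodic solution of (t^2/6) m'' = 1 - delta with m(0) = 0, where delta is
    the Dirac mass at 0. The additive constant is arbitrary, because convolution
    with a function of mean zero annihilates constants. *)
Definition green_profile t r : R := 3 / t ^+ 2 * (r ^+ 2 - r).

(** The function 3 (t - |s|)^2 / (2 t^3) on [-t,t] reduced modulo 1; it is 6/t^2
    times the Peano kernel of the error in replacing a function by its average. *)
Definition bump_profile t r : R :=
  3 / (2 * t ^+ 3) * (pospart (t - r) ^+ 2 + pospart (t - 1 + r) ^+ 2).

(** On [-1,2) the periodic extension is the quadratic plus a correction of its
    slope at each of the two integers 0 and 1. This avoids cases on the integer
    part in the integration that follows. *)
Lemma green_profile_tadd t z s : -1 <= z + s < 2 ->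
  green_profile t (z ⊕ s) = 3 / t ^+ 2 *
    ((z + s) ^+ 2 - (z + s) - 2 * pospart (z + s - 1) - 2 * pospart (- (z + s))).
Proof.
move=> /andP[h1 h2]; rewrite /green_profile.
have [h0|h0] := ltP (z + s) 0.
  rewrite (@taddE _ (-1)); last by rewrite rmorphN; lra.
  rewrite /pospart max_l ?max_r ?rmorphN; [ring|lra|lra].
have [h|h] := ltP (z + s) 1.
  rewrite (@taddE _ 0); last by rewrite add0r; lra.
  by rewrite /pospart !max_l; [ring|lra|lra].
rewrite (@taddE _ 1); last by lra.
rewrite /pospart max_r ?max_l; [ring|lra|lra].
Qed.

(** The corrections of slope in [green_profile_tadd] have as primitives the
    squares of positive parts, which evaluated at the ends of [-t,t] give,
    up to a common factor, the two terms of the bump. *)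
Lemma torus_avg_green t z : 0 < t < 1 -> 0 <= z < 1 ->
  torus_avg t (green_profile t) z = green_profile t z + 1 - bump_profile t z.
Proof.
move=> /andP[t0 t1] /andP[z0 z1].
(* F is the primitive in s of the formula of [green_profile_tadd]. *)
pose y : {poly R} := 'X + z%:P.
pose p : {poly R} := (3 / t ^+ 2)%:P * (3^-1%:P * y ^+ 3 - 2^-1%:P * y ^+ 2).
pose F s := p.[s] + - (3 / t ^+ 2) * pospart (1 * s + (z - 1)) ^+ 2
  + (3 / t ^+ 2) * pospart (-1 * s + - z) ^+ 2.
pose f s := p^`().[s] + - (3 / t ^+ 2) * (2 * 1 * pospart (1 * s + (z - 1)))
  + (3 / t ^+ 2) * (2 * -1 * pospart (-1 * s + - z)).
have dF x : is_derive x 1 F (f x).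
  exact: (is_deriveD (is_deriveD (is_derive_poly p x)
    (is_deriveZ _ (is_derive_pospart_sqr 1 (z - 1) x)))
    (is_deriveZ _ (is_derive_pospart_sqr (-1) (- z) x))).
have cf : continuous f.
  move=> x; apply: cvgD; first apply: cvgD; first exact: continuous_horner.
    apply: cvgM; first exact: cvg_cst.
    by apply: cvgM; [exact: cvg_cst|exact: continuous_pospart].
  apply: cvgM; first exact: cvg_cst.
  by apply: cvgM; [exact: cvg_cst|exact: continuous_pospart].
have Nt : - t < t by lra.
have I : (\int[lambda]_(s in `[(- t)%R, t]) (green_profile t (z ⊕ s))%:E =
    (F t - F (- t))%:E)%E.
  rewrite -(integral_antiderivative Nt dF cf); apply: eq_integral => s.
  rewrite inE/= in_itv/= => /andP[s1 s2]; congr EFin.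
  rewrite green_profile_tadd; last by apply/andP; split; lra.
  rewrite /f /p /y !poly.derivE !hornerE/=.
  have -> : s + z - 1 = z + s - 1 by ring.
  have -> : -1 * s - z = - (z + s) by ring.
  by field; lra.
rewrite /torus_avg /Rintegral I /=.
rewrite /F /p /y !hornerE/= /green_profile /bump_profile.
have -> : pospart (-1 * t - z) = 0 by rewrite /pospart max_l//; lra.
have -> : pospart (- t + z - 1) = 0 by rewrite /pospart max_l//; lra.
have -> : t + z - 1 = t - 1 + z by ring.
have -> : -1 * - t - z = t - z by ring.
by field; lra.
Qed.

Lemma measurable_green_profile t : measurable_fun [set: R] (green_profile t).
Proof.
by apply: measurable_funM => //; apply: measurable_funB => //; exact: measurable_funX.
Qed.

Lemma green_profile_bound t r : 0 < t -> 0 <= r < 1 ->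
  `|green_profile t r| <= 3 / (4 * t ^+ 2).
Proof.
move=> t0 /andP[r0 r1].
have -> : 3 / (4 * t ^+ 2) = 3 / t ^+ 2 * (1 / 4) by field; lra.
have h : 0 <= 3 / t ^+ 2 by rewrite divr_ge0// exprn_ge0// ltW.
rewrite /green_profile normrM (ger0_norm h) ler_wpM2l// ler_norml.
have := sqr_ge0 (r - 1 / 2); have : 0 <= r * (1 - r) by rewrite mulr_ge0//; lra.
by move=> h1 h2; apply/andP; split; nra.
Qed.

Lemma measurable_bump_profile t : measurable_fun [set: R] (bump_profile t).
Proof.
apply: measurable_funM => //; apply: measurable_funD; apply: measurable_funX.
- have := @continuous_pospart R (-1) t.
  under eq_fun do rewrite mulN1r addrC.
  exact: continuous_measurable_fun.
- have := @continuous_pospart R 1 (t - 1).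
  under eq_fun do rewrite mul1r addrC.
  exact: continuous_measurable_fun.
Qed.

Lemma bump_profile_bound t r : 0 < t -> 0 <= r < 1 ->
  `|bump_profile t r| <= 3 / t.
Proof.
move=> t0 /andP[r0 r1].
have -> : 3 / t = 3 / (2 * t ^+ 3) * (2 * t ^+ 2) by field; lra.
have h : 0 <= 3 / (2 * t ^+ 3) by rewrite divr_ge0// mulr_ge0// exprn_ge0// ltW.
rewrite /bump_profile normrM (ger0_norm h) ler_wpM2l// ger0_norm; last first.
  by rewrite addr_ge0// sqr_ge0.
have pb a : a <= t -> pospart a ^+ 2 <= t ^+ 2.
  by move=> at_; rewrite -subr_ge0 subr_sqr /pospart; case: (leP 0 a) => ?;
    rewrite mulr_ge0//; lra.
have := pb (t - r); have := pb (t - 1 + r); lra.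
Qed.

End profiles.

(** * The L1 distance between the average and the bump *)

Section excess.
Context {R : realType}.
Implicit Types x y z s a b t r u : R.
Local Notation lambda := (@lebesgue_measure R).

Lemma integral_deriv_affine (p : {poly R}) a b c e : a != 0 -> c < e ->
  (\int[lambda]_(s in `[c, e]) (p^`().[a * s + b])%:E =
   ((p.[a * e + b] - p.[a * c + b]) / a)%:E)%E.
Proof.
move=> a0 ce; pose q := a^-1 *: (p \Po (a *: 'X + b%:P)).
have qE s : q.[s] = a^-1 * p.[a * s + b].
  by rewrite hornerZ horner_comp !hornerE.
have dq s : q^`().[s] = p^`().[a * s + b].
  rewrite derivZ deriv_comp hornerZ hornerM horner_comp derivD derivZ derivX derivC.
  by rewrite !hornerE/=; field.
under eq_integral do rewrite -dq.
rewrite (integral_antiderivative ce (is_derive_poly q) (@continuous_horner _ _)).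
by rewrite !qE -mulrBr mulrC.
Qed.

Definition excess_profile t r : R := avg_profile t r - bump_profile t r.

(** With u = 1 - r/t on [0,t], and symmetrically near 1, the difference of the
    two profiles is (1 - 3 u^2)/(2t). Bounding |v| by (v^2/b + b)/2, with b = 9/10
    close to the root mean square of v = 1 - 3 u^2, leaves only polynomials to
    integrate; this one is a primitive in u of the resulting bound of |v|/2. *)
Definition excess_primitive : {poly R} :=
  2^-1%:P * ((5 / 9)%:P * ('X - 2%:P * 'X ^+ 3 + (9 / 5)%:P * 'X ^+ 5)
             + (9 / 20)%:P * 'X).

Lemma excess_primitive_deriv u :
  excess_primitive^`().[u] = ((1 - 3 * u ^+ 2) ^+ 2 * (10 / 9) + 9 / 10) / 4.
Proof. by rewrite /excess_primitive !poly.derivE !hornerE/=; field. Qed.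

Lemma excess_majorant u : `|1 - 3 * u ^+ 2| / 2 <= excess_primitive^`().[u].
Proof.
rewrite excess_primitive_deriv; move: (1 - 3 * u ^+ 2) => v.
rewrite -(real_normK (num_real v)); move: (`|v|) => w.
have := sqr_ge0 (w - 9 / 10); lra.
Qed.

Lemma excess_profile_le t r : 0 < t < 1 -> 0 <= r < 1 ->
  `|excess_profile t r| <=
  \1_(`[0, t] : set R) r * (t^-1 * excess_primitive^`().[- t^-1 * r + 1]) +
  \1_(`[1 - t, 1[ : set R) r *
    (t^-1 * excess_primitive^`().[t^-1 * r + (1 - t^-1)]).
Proof.
move=> /andP[t0 t1] /andP[r0 r1].
pose i1 : R := \1_(`[0, t] : set R) r; pose i2 : R := \1_(`[1 - t, 1[ : set R) r.
have i10 : 0 <= i1 by rewrite /i1 indicE.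
have i20 : 0 <= i2 by rewrite /i2 indicE.
have p1 : pospart (t - r) ^+ 2 = i1 * (t - r) ^+ 2.
  rewrite /i1 indicE mem_setE in_itv/= r0/= /pospart.
  case: (leP r t) => h; first by rewrite max_r ?mul1r//; lra.
  by rewrite max_l ?mul0r ?expr0n//; lra.
have p2 : pospart (t - 1 + r) ^+ 2 = i2 * (t - 1 + r) ^+ 2.
  rewrite /i2 indicE mem_setE in_itv/= r1/= andbT /pospart.
  case: (leP (1 - t) r) => h; first by rewrite max_r ?mul1r//; lra.
  by rewrite max_l ?mul0r ?expr0n//; lra.
have -> : excess_profile t r =
    i1 * (t^-1 * ((1 - 3 * (- t^-1 * r + 1) ^+ 2) / 2)) +
    i2 * (t^-1 * ((1 - 3 * (t^-1 * r + (1 - t^-1)) ^+ 2) / 2)).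
  rewrite /excess_profile /bump_profile /avg_profile p1 p2 -/i1 -/i2.
  by field; lra.
have ti0 : 0 <= t^-1 by rewrite invr_ge0 ltW.
rewrite (le_trans (ler_normD _ _))// !normrM (ger0_norm i10) (ger0_norm i20).
rewrite (ger0_norm ti0) (@ger0_norm _ 2^-1) ?invr_ge0//.
by rewrite lerD// ler_wpM2l// ler_wpM2l//; exact: excess_majorant.
Qed.

Lemma measurable_excess_profile t : measurable_fun [set: R] (excess_profile t).
Proof.
by apply: measurable_funB; [exact: measurable_avg_profile|
                            exact: measurable_bump_profile].
Qed.

(** The exact value of the bound is 161/180, since the integral of
    (1 - 3 u^2)^2 over [0,1] is 4/5. *)
Lemma excess_integral_le t : 0 < t < 1 ->
  (\int[lambda]_(r in `[0%R, 1%R[) `|excess_profile t r|%:E <= (9 / 10)%:E)%E.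
Proof.
move=> /[dup] t01 /andP[t0 t1].
have ti0 : 0 <= t^-1 by rewrite invr_ge0 ltW.
pose Q u := t^-1 * excess_primitive^`().[u].
have Q0 u : 0 <= Q u.
  by rewrite mulr_ge0// (le_trans _ (excess_majorant u))// divr_ge0.
have mQ a b : measurable_fun [set: R] (fun s => Q (a * s + b)).
  apply: measurable_funM => //.
  apply: (measurableT_comp (continuous_measurable_fun (@continuous_horner _ _))).
  by apply: measurable_funD => //; exact: measurable_funM.
have mi (A : set R) a b : measurable A ->
    measurable_fun [set: R] (fun s => (\1_A s * Q (a * s + b))%:E).
  by move=> mA; apply/measurable_EFinP; exact: measurable_funM.
apply: (@le_trans _ _ (\int[lambda]_(r in `[0%R, 1%R[)
  ((\1_(`[0%R, t] : set R) r * Q (- t^-1 * r + 1)%R)%:E +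
   (\1_(`[(1 - t)%R, 1%R[ : set R) r * Q (t^-1 * r + (1 - t^-1))%R)%:E))%E).
  apply: ge0_le_integral => //.
  - apply/measurable_EFinP; apply: measurable_funTS; apply: measurableT_comp => //.
    exact: measurable_excess_profile.
  - apply: measurable_funTS; apply: emeasurable_funD; exact: mi.
  - move=> r /=; rewrite in_itv/= => r01; rewrite -EFinD lee_fin.
    exact: excess_profile_le.
rewrite ge0_integralD//; last 4 first.
- by move=> r _; rewrite lee_fin mulr_ge0// indicE.
- by apply: measurable_funTS; exact: mi.
- by move=> r _; rewrite lee_fin mulr_ge0// indicE.
- by apply: measurable_funTS; exact: mi.
rewrite !integral_indicM//; last 2 first.
- by move=> s /=; rewrite !in_itv/= => /andP[h1 h2]; apply/andP; split; lra.
- by move=> s /=; rewrite !in_itv/= => /andP[h1 h2]; apply/andP; split; lra.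
rewrite integral_itv_bndo_bndc; last first.
  by apply: measurable_funTS; apply/measurable_EFinP; exact: mQ.
pose q := t^-1 *: excess_primitive.
have qQ u : Q u = q^`().[u] by rewrite derivZ hornerZ.
under eq_integral do rewrite qQ.
under [X in (_ + X)%E]eq_integral do rewrite qQ.
have tn0 : t^-1 != 0 by rewrite invr_eq0; lra.
rewrite !integral_deriv_affine ?oppr_eq0//; last by lra.
rewrite -EFinD lee_fin !hornerZ.
have -> : - t^-1 * t + 1 = 0 by field; lra.
have -> : - t^-1 * 0 + 1 = 1 by ring.
have -> : t^-1 * 1 + (1 - t^-1) = 1 by ring.
have -> : t^-1 * (1 - t) + (1 - t^-1) = 0 by field; lra.
rewrite /excess_primitive !hornerE/=.
by rewrite [leLHS](_ : _ = 161 / 180); [lra|field; lra].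
Qed.
End excess.

(** * Recovering a function from its defect *)

Section assembly.
Context {R : realType}.
Implicit Types x y z s a b t r u : R.
Local Notation tau := (@torus_measure R).
Local Notation lambda := (@lebesgue_measure R).
Local Notation U t := (conv_kernel (avg_profile t)).
Local Notation M t := (conv_kernel (green_profile t)).
Local Notation W t := (conv_kernel (bump_profile t)).
Local Notation V t := (conv_kernel (excess_profile t)).
Local Notation bker := (@bounded_kernel _ (measurableTypeR R) R).

Lemma bounded_avg_kernel t : 0 < t -> bker (U t).
Proof.
move=> t0; apply: (bounded_conv_kernel (measurable_avg_profile t)) => r _.
exact: avg_profile_bound.
Qed.

Lemma bounded_green_kernel t : 0 < t -> bker (M t).
Proof.
move=> t0; apply: (bounded_conv_kernel (measurable_green_profile t)) => r.
exact: green_profile_bound.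
Qed.

Lemma bounded_bump_kernel t : 0 < t -> bker (W t).
Proof.
move=> t0; apply: (bounded_conv_kernel (measurable_bump_profile t)) => r.
exact: bump_profile_bound.
Qed.

Lemma bounded_excess_kernel t : 0 < t -> bker (V t).
Proof.
move=> t0; apply: (@bounded_conv_kernel _ _ (t^-1 + 3 / t)).
  exact: measurable_excess_profile.
move=> r r01; rewrite (le_trans (ler_normB _ _))// lerD//.
  exact: avg_profile_bound.
exact: bump_profile_bound.
Qed.

Lemma avg_kernel_sym t x y : U t x y = U t y x.
Proof.
apply: conv_kernel_sym => r /andP[r0 r1]; rewrite /avg_profile !indicE !mem_setE.
rewrite !in_itv/=.
have -> : (0 <= 1 - r <= t) = (1 - t <= r < 1) by apply/idP/idP; lra.
have -> : (1 - t <= 1 - r < 1) = (0 <= r <= t) by apply/idP/idP; lra.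
by rewrite addrC.
Qed.

Lemma bump_kernel_sym t x y : W t x y = W t y x.
Proof.
apply: conv_kernel_sym => r _; rewrite /bump_profile addrC.
by congr (_ * (pospart _ ^+ 2 + pospart _ ^+ 2)); ring.
Qed.

Lemma excess_kernel_sym t x y : V t x y = V t y x.
Proof. by have := avg_kernel_sym t x y; have := bump_kernel_sym t x y;
  rewrite /conv_kernel /excess_profile => -> ->. Qed.

Lemma green_kernel_sym t x y : M t x y = M t y x.
Proof. by apply: conv_kernel_sym => r _; rewrite /green_profile; ring. Qed.

(** The symmetry of the averaging kernel turns the composition of the two
    kernels into the average of a translate of the Green function. *)
Lemma green_avg_kernel t x z : 0 < t < 1 ->
  \int[tau]_y (M t x y * U t y z) = M t x z + 1 - W t x z.
Proof.
move=> t01; have /andP[t0 t1] := t01.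
rewrite -(_ : torus_avg t (M t x) z = M t x z + 1 - W t x z); last first.
  rewrite /conv_kernel -torus_avg_green ?tadd_ge0 ?tadd_lt1// /torus_avg.
  congr (_ * _); apply: eq_Rintegral => s _; congr green_profile.
  rewrite !tadd_taddl; congr (_ ⊕ _); ring.
rewrite torus_avgE//; last exact: integrable_kernel (bounded_green_kernel t0).
by apply: eq_Rintegral => y _; rewrite mulrC avg_kernel_sym.
Qed.

(** Composing with the Green kernel replaces M U f by M f + (integral of f) - W f,
    and the integral vanishes by hypothesis. *)
Lemma green_representation t (f : R -> R) x : 0 < t < 1 ->
  tau.-integrable setT (EFin \o f) -> (\int[tau]_y (f y)%:E = 0)%E ->
  f x = kernel_op tau (V t) f x +
    ((f \- torus_avg t f) x + kernel_op tau (M t) (f \- torus_avg t f) x).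
Proof.
move=> t01 fi f0; have /andP[t0 t1] := t01.
have bU := bounded_avg_kernel t0; have bM := bounded_green_kernel t0.
have bW := bounded_bump_kernel t0.
have b1 := @bounded_kernel_cst _ (measurableTypeR R) R 1.
have -> : torus_avg t f = kernel_op tau (U t) f.
  by apply/funext => y; exact: torus_avgE.
rewrite kernel_opBr//; last exact: integrable_kernel_op.
rewrite kernel_op_comp//.
have -> : kernel_op tau (fun x z => \int[tau]_y (M t x y * U t y z)) f x =
    kernel_op tau (M t) f x - kernel_op tau (W t) f x.
  transitivity (kernel_op tau (fun x z => (M t x z + 1) - W t x z) f x).
    by apply: eq_Rintegral => z _; rewrite green_avg_kernel.
  rewrite kernel_opBl//; last exact: bounded_kernelD.
  rewrite kernel_opDl// (_ : kernel_op tau (fun _ _ => 1) f x = 0) ?addr0//.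
  rewrite /kernel_op /Rintegral.
  by under eq_integral do rewrite mul1r; rewrite f0.
have -> : kernel_op tau (V t) f x =
    kernel_op tau (U t) f x - kernel_op tau (W t) f x by exact: kernel_opBl.
by rewrite /=; ring.
Qed.

End assembly.

Theorem theorem1 (R : realType) :
  exists c : R, 0 < c /\
    forall (t : R) (p : \bar R) (f : R -> R),
      0 < t < 1 ->
      (1 <= p)%E ->
      f \in Lfun torus_measure p ->
      (\int[torus_measure]_x (f x)%:E = 0)%E ->
      ((c * t ^+ 2)%:E * 'N[torus_measure]_p[EFin \o f]
       <= 'N[torus_measure]_p[EFin \o (f \- torus_avg t f)%R])%E.
Proof.
exists (1 / 20); split; first by lra.
move=> t p f t01 p1 fp f0; have /andP[t0 t1] := t01.
have f1 : f \in Lfun (@torus_measure R) 1.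
  by apply: (Lfun_subset _ _ _ p1 fp) => //; rewrite fin_num_measure.
have fi := f1; move/Lfun1_integrable in fi.
have Nf : ('N[(@torus_measure R)]_p[EFin \o f] < +oo)%E.
  by move: fp => /andP[_]; rewrite inE.
have bU := bounded_avg_kernel t0.
have bM := bounded_green_kernel t0.
have bV := bounded_excess_kernel t0.
pose g := f \- torus_avg t f.
have gE : g = f \- kernel_op torus_measure (conv_kernel (avg_profile t)) f.
  by apply/funext => y; rewrite /g /= torus_avgE.
have gi : (@torus_measure R).-integrable setT (EFin \o g).
  by rewrite gE; exact: (integrableB _ fi (integrable_kernel_op bU fi)).
set Nfv := ('N[torus_measure]_p[EFin \o f])%E.
set Ng := ('N[torus_measure]_p[EFin \o (f \- torus_avg t f)%R])%E.
have NV : ('N[torus_measure]_p[EFin \o kernel_op torus_measure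
     (conv_kernel (excess_profile t)) f] <= (9 / 10)%:E * Nfv)%E.
  apply: schur_test => //.
    by move=> x; rewrite integral_conv_kernel ?excess_integral_le//;
       exact: measurable_excess_profile.
  move=> y; under eq_integral do rewrite excess_kernel_sym.
  by rewrite integral_conv_kernel ?excess_integral_le//;
       exact: measurable_excess_profile.
have NM : ('N[torus_measure]_p[EFin \o kernel_op torus_measure
     (conv_kernel (green_profile t)) g] <= (3 / (4 * t ^+ 2))%:E * Ng)%E.
  have h x : (\int[torus_measure]_y `|conv_kernel (green_profile t) x y|%:E
      <= (3 / (4 * t ^+ 2))%:E)%E.
    rewrite -[leRHS]mule1 -(torus_measure_setT R) -integral_cst//.
    apply: ge0_le_integral => //.
    - apply/measurable_EFinP/measurableT_comp => //.
      exact: measurable_kernel_section bM.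
    - by move=> y _; rewrite lee_fin green_profile_bound// tadd_ge0 tadd_lt1.
  apply: schur_test => //; first by rewrite divr_ge0// mulr_ge0// sqr_ge0.
  by move=> y; under eq_integral do rewrite green_kernel_sym.
have mf : measurable_fun [set: R] f by apply/measurable_EFinP; exact: measurable_int fi.
have mg : measurable_fun [set: R] g by apply/measurable_EFinP; exact: measurable_int gi.
have : (Nfv <= (9 / 10)%:E * Nfv + (Ng + (3 / (4 * t ^+ 2))%:E * Ng))%E.
  have mVf := measurable_kernel_op bV fi.
  have mMg := measurable_kernel_op bM gi.
  rewrite {1}/Nfv (_ : f = kernel_op torus_measure (conv_kernel (excess_profile t)) f \+
    (g \+ kernel_op torus_measure (conv_kernel (green_profile t)) g)); last first.
    by apply/funext => x; exact: green_representation.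
  apply: le_trans (eminkowski _ _ _ p1) _ => //; first exact: measurable_funD.
  apply: leeD => //.
  apply: le_trans (eminkowski _ _ _ p1) _ => //.
  exact: leeD.
have Ng0 : (0 <= Ng)%E by exact: Lnorm_ge0.
have Nf0 : (0 <= Nfv)%E by exact: Lnorm_ge0.
(* Absorbing (9/10) |f| into the left-hand side needs finite norms. That of f is
   finite by membership in L_p, and an infinite norm of g makes the claim trivial. *)
have [->|Ngy] := eqVneq Ng +oo%E; first by rewrite leey.
have := ge0_fin_numE Nf0; rewrite Nf => /fineK <-.
have /fineK <- : Ng \is a fin_num by rewrite ge0_fin_numE// ltey.
have := fine_ge0 Ng0; have := fine_ge0 Nf0.
move: (fine Ng) (fine Nfv) => b a a0 b0.
rewrite -!EFinM -!EFinD !lee_fin => h.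
have : t ^+ 2 * a <= t ^+ 2 * (9 / 10 * a + (b + 3 / (4 * t ^+ 2) * b)).
  by rewrite ler_wpM2l// sqr_ge0.
have -> : t ^+ 2 * (9 / 10 * a + (b + 3 / (4 * t ^+ 2) * b)) =
   9 / 10 * (t ^+ 2 * a) + (t ^+ 2 * b + 3 / 4 * b) by field; lra.
(* What remains is t^2 a / 10 <= (t^2 + 3/4) b, and t^2 + 3/4 < 2. *)
have : t ^+ 2 * b <= b by rewrite ler_piMl// expr_le1// ltW.
rewrite mulrA; lra.
Qed.
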